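(* Let $K$ and $L$ be two (disjoint) finite simplicial complexes. Then the join $K*L$ is strong collapsible if and only if $K$ is strong collapsible or $L$ is strong collapsible.
   Context: All simplicial complexes are finite (simplices are nonempty finite sets of vertices). The join $K*L$ of two complexes with disjoint vertex sets is the complex whose simplices are those of $K$, those of $L$, and the unions $\sigma\cup\tau$ with $\sigma\in K$, $\tau\in L$. For a vertex $v$ of a complex $K$, the link $\mathrm{lk}_K(v)$ is the subcomplex of simplices $\tau\in K$ with $v\notin\tau$ and $\tau\cup\{v\}\in K$, and $K\smallsetminus v$ is the full subcomplex of $K$ spanned by the vertices different from $v$. A simplicial cone is a complex $aM$, the join of a (possibly empty) complex $M$ and a vertex $a$ not in $M$. A vertex $v$ of $K$ is dominated if $\mathrm{lk}_K(v)$ is a simplicial cone; in that case there is an elementary strong collapse from $K$ to $K\smallsetminus v$. A strong collapse from $K$ to a subcomplex $L$ is a finite (possibly empty) sequence of elementary strong collapses starting in $K$ and ending in $L$. A complex is strong collapsible if it strong collapses to one of its vertices. *)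

(* Defs.v *)
From mathcomp Require Import all_boot finmap.

Set Implicit Arguments.
Unset Strict Implicit.
Unset Printing Implicit Defensive.

Local Open Scope fset_scope.

(* A finite family of finite sets over an arbitrary choiceType; the empty
   complex is allowed. *)
Definition simplicial_complex (V : choiceType) (K : {fset {fset V}}) : Prop :=
  (forall s : {fset V}, s \in K -> s != fset0) /\
  (forall s t : {fset V}, s \in K -> t `<=` s -> t != fset0 -> t \in K).

Definition vertices (V : choiceType) (K : {fset {fset V}}) : {fset V} :=
  \bigcup_(s <- K) s.

Definition vertex_complex (V : choiceType) (v : V) : {fset {fset V}} :=
  [fset [fset v]].

Definition join (V : choiceType) (K L : {fset {fset V}}) : {fset {fset V}} :=
  K `|` L `|` [fset s `|` t | s in K, t in L].

Definition link (V : choiceType) (K : {fset {fset V}}) (v : V) :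
    {fset {fset V}} :=
  [fset t in K | (v \notin t) && (v |` t \in K)].

Definition full_subcomplex (V : choiceType) (K : {fset {fset V}})
    (W : {fset V}) : {fset {fset V}} :=
  [fset s in K | s `<=` W].

Definition deletion (V : choiceType) (K : {fset {fset V}}) (v : V) :
    {fset {fset V}} :=
  full_subcomplex K (vertices K `\ v).

(* M may be empty, in which case the cone is the single vertex a; the empty
   complex itself is not a cone. *)
Definition simplicial_cone (V : choiceType) (C : {fset {fset V}}) : Prop :=
  exists (a : V) (M : {fset {fset V}}),
    [/\ simplicial_complex M, a \notin vertices M
      & C = join (vertex_complex a) M].

Definition dominated (V : choiceType) (K : {fset {fset V}}) (v : V) : Prop :=
  v \in vertices K /\ simplicial_cone (link K v).

Inductive strong_collapse (V : choiceType) (K : {fset {fset V}}) :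
    {fset {fset V}} -> Prop :=
| strong_collapse_refl : strong_collapse K K
| strong_collapse_step (L : {fset {fset V}}) (v : V) :
    strong_collapse K L -> dominated L v -> strong_collapse K (deletion L v).

Definition strong_collapsible (V : choiceType) (K : {fset {fset V}}) : Prop :=
  exists2 v : V, v \in vertices K & strong_collapse K (vertex_complex v).

(* Main.v *)
(* Write v for a vertex of K.  Then lk_{K*L}(v) = lk_K(v) * L, and a join is a
   cone if and only if one of its factors is.  Hence every elementary strong
   collapse of K * L either is one of K or of L, or occurs when a factor has
   become a cone, and cones are strong collapsible.  No uniqueness of cores is
   needed. *)
Require Import Defs.
From mathcomp Require Import all_boot finmap.

Local Open Scope fset_scope.

Section Complexes.

Context {V : choiceType}.
Implicit Types (K L M : {fset {fset V}}) (s t A : {fset V}) (a v : V).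

(** * Vertices, links and deletions *)

Lemma in_verticesP K v :
  reflect (exists2 s, s \in K & v \in s) (v \in vertices K).
Proof.
apply: (iffP (bigfcupP _ _ _ _)).
  by case=> s; rewrite andbT => sK vs; exists s.
by case=> s sK vs; exists s; rewrite ?sK.
Qed.

Lemma sub_vertices K s : s \in K -> s `<=` vertices K.
Proof. by move=> sK; apply/fsubsetP => v vs; apply/in_verticesP; exists s. Qed.

Lemma verticesS K L : K `<=` L -> vertices K `<=` vertices L.
Proof.
move=> /fsubsetP KL; apply/fsubsetP => v /in_verticesP [s /KL sL vs].
by apply/in_verticesP; exists s.
Qed.

Lemma fset1_in_complex K v :
  simplicial_complex K -> v \in vertices K -> [fset v] \in K.
Proof.
move=> [_ hK] /in_verticesP [s sK vs]; apply: (hK s) => //.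
  by rewrite fsub1set.
by apply/fset0Pn; exists v; rewrite inE.
Qed.

Lemma fsetU1_neq0 v s : v |` s != fset0.
Proof. by apply/fset0Pn; exists v; rewrite !inE eqxx. Qed.

Lemma simplicial_vertex_complex v : simplicial_complex (vertex_complex v).
Proof.
have v0 : [fset v] != fset0 by apply/fset0Pn; exists v; rewrite inE.
split=> [s | s t]; rewrite inE => /eqP -> //.
by rewrite fsubset1 => /orP [/eqP -> _ | ->] //; rewrite inE.
Qed.

Lemma in_link K v t :
  (t \in link K v) = [&& t \in K, v \notin t & v |` t \in K].
Proof. by rewrite !inE. Qed.

Lemma in_deletion K v s : (s \in deletion K v) = (s \in K) && (v \notin s).
Proof.
rewrite !inE; case sK: (s \in K) => //=.
by rewrite fsubsetD1 sub_vertices.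
Qed.

Lemma deletion_sub K v : deletion K v `<=` K.
Proof. by apply/fsubsetP => s; rewrite in_deletion => /andP []. Qed.

Lemma simplicial_deletion K v :
  simplicial_complex K -> simplicial_complex (deletion K v).
Proof.
move=> [K0 hK]; split=> [s | s t]; rewrite !in_deletion.
  by move=> /andP [/K0].
move=> /andP [sK vs] ts t0; rewrite (hK s) //=.
by apply: contra vs; apply: (fsubsetP ts).
Qed.

Lemma simplicial_link K v :
  simplicial_complex K -> simplicial_complex (link K v).
Proof.
move=> [K0 hK]; split=> [s | s t]; rewrite !in_link.
  by move=> /andP [/K0].
move=> /and3P [sK vs vsK] ts t0; rewrite (hK s) //=; apply/andP; split.
  by apply: contra vs; apply: (fsubsetP ts).
by apply: (hK (v |` s)); rewrite ?fsetU1_neq0 // fsetUS.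
Qed.

(** * Simplices of a join *)

Lemma in_joinP K L s :
  reflect [\/ s \in K, s \in L
             | exists2 p : {fset V} * {fset V},
                 p.1 \in K /\ p.2 \in L & s = p.1 `|` p.2]
          (s \in join K L).
Proof.
rewrite !in_fsetU; apply: (iffP idP).
  case/orP=> [/orP [] | /imfset2P [t tK [u uL ->]]];
    [by constructor 1 | by constructor 2 |].
  by constructor 3; exists (t, u).
case=> [-> | -> | [[t u] /= [tK uL] ->]]; rewrite ?orbT //.
by apply/orP; right; apply/imfset2P; exists t => //; exists u.
Qed.

Lemma joinC K L : join K L = join L K.
Proof.
apply/fsetP => s; apply/in_joinP/in_joinP;
  case=> [|| [[t u] /= [tK uL] ->]]; try by [constructor 1 | constructor 2];
  by constructor 3; exists (u, t); rewrite // fsetUC.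
Qed.

(** A set [A] that contains the vertices of [K] and misses those of [L] cuts each simplex of the
    join into its two factors; adding [fset0] allows one factor to be absent. Leaving [A] free lets
    [vertices K] serve both for [K] and for the smaller complex [link K v]. *)
Lemma join_splitP K L A s :
  simplicial_complex K -> simplicial_complex L ->
  vertices K `<=` A -> [disjoint vertices L & A] ->
  reflect [/\ s != fset0, s `&` A \in fset0 |` K & s `\` A \in fset0 |` L]
          (s \in join K L).
Proof.
move=> [K0 _] [L0 _] KA LA.
have hA t : t \in K -> t `<=` A by move/sub_vertices/fsubset_trans; apply.
have hB t : t \in L -> [disjoint t & A].
  by move/sub_vertices/fdisjointWl; apply.
apply: (iffP (in_joinP _ _ _)).
  case=> [sK | sL | [[t u] /= [tK uL] ->]].
  - have sA := hA _ sK.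
    have sD : s `\` A = fset0 by apply/eqP; rewrite fsetD_eq0.
    by rewrite K0 // (fsetIidPl sA) sD !inE eqxx sK orbT.
  - have sA := hB _ sL.
    by rewrite L0 // (fsetDidPl _ _ sA) (eqP sA) !inE eqxx sL orbT.
  - have tA := hA _ tK; have uA := hB _ uL.
    have tD : t `\` A = fset0 by apply/eqP; rewrite fsetD_eq0.
    rewrite fsetIUl fsetDUl (fsetIidPl tA) tD (eqP uA) (fsetDidPl _ _ uA).
    by rewrite fsetU0 fset0U !inE tK uL !orbT fsetU_eq0 negb_and K0.
move=> [s0]; rewrite !inE; have sE := fsetID A s.
(* The four cases say which parts of [s] are empty; both cannot be, as [s] is nonempty. *)
case/orP=> [/eqP sI | sK] /orP [/eqP sD | sL].
- by rewrite -sE sI sD fset0U eqxx in s0.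
- by constructor 2; rewrite -sE sI fset0U.
- by constructor 1; rewrite -sE sD fsetU0.
- by constructor 3; exists (s `&` A, s `\` A).
Qed.

Lemma simplicial_join K L :
  simplicial_complex K -> simplicial_complex L -> simplicial_complex (join K L).
Proof.
move=> [K0 hK] [L0 hL]; split=> [s | s r].
  case/in_joinP=> [/K0 | /L0 | [[t u] /= [/K0 t0 _] ->]] //.
  by rewrite fsetU_eq0 negb_and t0.
case/in_joinP=> [sK rs r0 | sL rs r0 | [[t u] /= [tK uL] ->] rs r0].
- by apply/in_joinP; constructor 1; apply: (hK s).
- by apply/in_joinP; constructor 2; apply: (hL s).
(* A face of [t] joined to [u] is the union of its traces on [t] and [u], each of which is empty or
   a simplex of its factor. *)
have rE : r = (r `&` t) `|` (r `&` u) by rewrite -fsetIUr (fsetIidPl rs).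
have rK : r `&` t != fset0 -> r `&` t \in K by apply: (hK t); rewrite ?fsubsetIr.
have rL : r `&` u != fset0 -> r `&` u \in L by apply: (hL u); rewrite ?fsubsetIr.
apply/in_joinP.
case: (eqVneq (r `&` t) fset0) => [rt | /rK {}rK].
  constructor 2; rewrite rE rt fset0U; apply: rL.
  by apply: contraNneq r0 => ru; rewrite rE rt ru fset0U.
case: (eqVneq (r `&` u) fset0) => [ru | /rL {}rL].
  by constructor 1; rewrite rE ru fsetU0.
by constructor 3; exists (r `&` t, r `&` u).
Qed.

(** * Cones described by their apex *)

(** Working form of being a cone: a closure condition on [K] alone, with no base to choose. The
    first clause excludes the empty complex. *)
Definition apex K a : Prop :=
  [fset a] \in K /\ forall t, t \in K -> a |` t \in K.

(** The base can be recovered as [deletion K a]: a simplex containing [a], other than [[fset a]], is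
    [a] added to a simplex that avoids [a]. *)
Lemma simplicial_coneP K :
  simplicial_complex K -> (simplicial_cone K <-> exists a, apex K a).
Proof.
move=> cK; split.
  case=> a [M [_ _ ->]]; exists a; split.
    by apply/in_joinP; constructor 1; rewrite inE.
  move=> t /in_joinP [| tM | [[u s] /= []]].
  - rewrite inE => /eqP ->; rewrite fsetUid.
    by apply/in_joinP; constructor 1; rewrite inE.
  - by apply/in_joinP; constructor 3; exists ([fset a], t); rewrite ?inE.
  - rewrite inE => /eqP -> sM ->; rewrite fsetUA fsetUid.
    by apply/in_joinP; constructor 3; exists ([fset a], s); rewrite ?inE.
case=> a [aK haK]; exists a, (deletion K a); split.
- exact: simplicial_deletion.
- by apply/in_verticesP => -[s]; rewrite in_deletion => /andP [_ /negP].
apply/fsetP => s; apply/idP/in_joinP.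
  move=> sK; case as_: (a \in s); last by constructor 2; rewrite in_deletion sK as_.
  case: (eqVneq (s `\ a) fset0) => [s0 | s0].
    by constructor 1; rewrite inE -(fsetD1K as_) s0 fsetU0.
  constructor 3; exists ([fset a], s `\ a); last by rewrite fsetD1K.
  rewrite inE eqxx in_deletion !inE eqxx andbT; split=> //.
  by case: cK => _ hK; apply: (hK s); rewrite ?fsubD1set ?fsubsetDl.
case=> [||[[u t] /= [+ +] ->]]; rewrite ?in_deletion ?inE.
- by move/eqP ->.
- by case/andP.
- by move=> /eqP -> /andP [/haK].
Qed.

Lemma dominatedP K v :
  simplicial_complex K ->
  (dominated K v <-> v \in vertices K /\ exists a, apex (link K v) a).
Proof.
move=> cK; have := simplicial_coneP _ (simplicial_link _ v cK).
by rewrite /dominated => ->.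
Qed.

(** * Strong collapses, and the collapse of a cone to its apex *)

Lemma strong_collapse_complex K L :
  strong_collapse K L -> simplicial_complex K ->
  simplicial_complex L /\ L `<=` K.
Proof.
move=> KL cK; elim: KL => [|L' v _ [cL LK] _]; first by rewrite fsubset_refl.
split; first exact: simplicial_deletion.
exact: fsubset_trans (deletion_sub _ _) LK.
Qed.

Lemma strong_collapse_trans K L M :
  strong_collapse K L -> strong_collapse L M -> strong_collapse K M.
Proof. by move=> KL; elim=> // M' v _; apply: strong_collapse_step. Qed.

Lemma strong_collapse_collapsible K L :
  simplicial_complex K -> strong_collapse K L -> strong_collapsible L ->
  strong_collapsible K.
Proof.
move=> cK KL [v vL Lv]; exists v; last exact: strong_collapse_trans Lv.
by have [_ /verticesS/fsubsetP] := strong_collapse_complex _ _ KL cK; apply.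
Qed.

(** For each vertex [v] other than [a], the link of [v] is again a cone with apex [a], so [v] is
    dominated; deleting [v] leaves a smaller cone with apex [a]. The induction is on the number of
    simplices. *)
Lemma apex_collapse K a :
  simplicial_complex K -> apex K a -> strong_collapse K (vertex_complex a).
Proof.
have [n] := ubnP #|` K|; elim: n K => // n IH K /ltnSE Kn cK [aK haK].
have [/eqP Ka | [v /fsetD1P [va vK]]] := fset_0Vmem (vertices K `\ a).
  suff -> : vertex_complex a = K by apply: strong_collapse_refl.
  apply/fsetP => s; rewrite inE; apply/eqP/idP => [-> // | sK].
  rewrite fsetD_eq0 in Ka.
  have := fsubset_trans (sub_vertices _ _ sK) Ka.
  by rewrite fsubset1 => /orP [/eqP | s0] //; case: cK => /(_ _ sK); rewrite s0.
have v1 := fset1_in_complex _ _ cK vK.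
have aP : apex (link K v) a.
  split; first by rewrite in_link aK inE va fsetUC haK.
  move=> t; rewrite !in_link => /and3P [tK vt vtK].
  by rewrite haK // !inE (negbTE va) vt fsetUCA haK.
apply: (@strong_collapse_trans _ (deletion K v)).
  apply: strong_collapse_step (strong_collapse_refl _) _.
  by apply/dominatedP => //; split=> //; exists a.
apply: IH; [| exact: simplicial_deletion | split].
- apply: leq_trans Kn; apply: fproper_ltn_card.
  (* The simplex [[fset v]] is lost in the deletion, so the count strictly drops. *)
  apply: fsub_proper_trans (fproperD1 v1).
  apply/fsubsetP => s; rewrite in_deletion !inE => /andP [-> vs].
  by rewrite andbT; apply: contraNneq vs => ->; rewrite inE.
- by rewrite in_deletion aK inE va.
- move=> t; rewrite !in_deletion => /andP [tK vt].
  by rewrite haK // !inE (negbTE va).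
Qed.

Lemma apex_collapsible K a :
  simplicial_complex K -> apex K a -> strong_collapsible K.
Proof.
move=> cK aP; exists a; last exact: apex_collapse.
by apply/in_verticesP; exists [fset a]; [case: aP | rewrite inE].
Qed.

(** Adding [a] to a simplex of the join only changes its part in [K], and creates that part when it
    is absent. *)
Lemma apex_joinl K L a : apex K a -> apex (join K L) a.
Proof.
move=> [aK haK]; split; first by apply/in_joinP; constructor 1.
move=> s /in_joinP sJ; apply/in_joinP; case: sJ => [sK | sL | [[t u] /= [tK uL] ->]].
- by constructor 1; apply: haK.
- by constructor 3; exists ([fset a], s).
- by constructor 3; exists (a |` t, u); rewrite /= ?fsetUA //; split=> //; apply: haK.
Qed.

(** * Apices, links and deletions in a join of disjoint complexes *)

Section Disjoint.

Variables K L : {fset {fset V}}.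
Hypothesis cK : simplicial_complex K.
Hypothesis cL : simplicial_complex L.
Hypothesis dKL : [disjoint vertices K & vertices L].

Lemma apex_join_factorl a :
  a \in vertices K -> apex (join K L) a -> apex K a.
Proof.
move=> aK [_ haJ]; split; first exact: fset1_in_complex.
move=> t tK; have/haJ : t \in join K L by apply/in_joinP; constructor 1.
have dLK : [disjoint vertices L & vertices K] by rewrite fdisjoint_sym.
move/(join_splitP _ _ _ _ cK cL (fsubset_refl _) dLK) => [_ + _].
rewrite (fsetIidPl _); first by rewrite !inE (negbTE (fsetU1_neq0 _ _)).
by rewrite fsubUset fsub1set aK sub_vertices.
Qed.

(** Both sides are split along the vertices of [K]: adding [v] acts on the part of [s] inside this
    set and leaves the part outside unchanged. *)
Lemma link_joinl v :
  v \in vertices K -> link (join K L) v = join (link K v) L.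
Proof.
move=> vK; set A := vertices K.
have dLK : [disjoint vertices L & A] by rewrite fdisjoint_sym.
have v1 := fset1_in_complex _ _ cK vK.
have lA : vertices (link K v) `<=` A.
  by apply: verticesS; apply/fsubsetP => s; rewrite in_link => /andP [].
have JP s := join_splitP _ _ _ s cK cL (fsubset_refl _) dLK.
have vI s : (v |` s) `&` A = v |` (s `&` A).
  by rewrite fsetIUl (fsetIidPl _) // fsub1set.
have vD s : (v |` s) `\` A = s `\` A.
  have /eqP vA : [fset v] `\` A == fset0 by rewrite fsetD_eq0 fsub1set.
  by rewrite fsetDUl vA fset0U.
apply/fsetP => s; rewrite in_link.
apply/and3P/(join_splitP _ _ _ _ (simplicial_link _ v cK) cL lA dLK).
  move=> [/JP [s0 sI sD] vs /JP [_ vsI _]]; split=> //.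
  move: sI vsI; rewrite vI !inE (negbTE (fsetU1_neq0 _ _)) /=.
  by case/orP=> [-> // | -> ->]; rewrite (negbTE vs) orbT.
move=> [s0 sI sD].
(* If the part of [s] in [A] is empty, then [v], which lies in [A], is not in [s], and the last
   claim reduces to [[fset v]] being a simplex of [K]. *)
have [sI' vs vsI] : [/\ s `&` A \in fset0 |` K, v \notin s & v |` (s `&` A) \in K].
  move: sI; rewrite !inE => /orP [/eqP sI | /and3P [-> + ->]].
    rewrite sI eqxx fsetU0; split=> //; apply/negP => vs.
    by have := in_fset0 v; rewrite -sI !inE vs vK.
  by rewrite vK andbT orbT => ->.
split=> //; first exact/JP.
by apply/JP; rewrite vI vD fsetU1_neq0 !inE vsI orbT -in_fset1U.
Qed.

(** By disjointness [v] lies in no simplex of [L], so a simplex of the join avoids [v] exactly when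
    its part in [K] does. *)
Lemma deletion_joinl v :
  v \in vertices K -> deletion (join K L) v = join (deletion K v) L.
Proof.
move=> vK.
have vL t : t \in L -> v \notin t.
  move=> tL; apply: contraTN vK => vt; apply/negP => /(fdisjointP dKL)/negP [].
  by apply/in_verticesP; exists t.
apply/fsetP => s; rewrite in_deletion; apply/andP/in_joinP.
  case=> /in_joinP [sK | sL | [[t u] /= [tK uL] ->]] vs.
  - by constructor 1; rewrite in_deletion sK.
  - by constructor 2.
  - constructor 3; exists (t, u) => //=; rewrite in_deletion tK; split=> //.
    by apply: contra vs => vt; rewrite inE vt.
case=> [| sL | [[t u] /= []]].
- by rewrite in_deletion => /andP [sK ->]; split=> //; apply/in_joinP; constructor 1.
- by rewrite vL //; split=> //; apply/in_joinP; constructor 2.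
- rewrite in_deletion => /andP [tK vt] uL ->.
  rewrite in_fsetU (negbTE vt) vL //; split=> //.
  by apply/in_joinP; constructor 3; exists (t, u).
Qed.

End Disjoint.

(** * Cones and strong collapses of joins *)

Lemma vertices_join K L : vertices (join K L) = vertices K `|` vertices L.
Proof.
apply/fsetP => v; rewrite inE; apply/in_verticesP/orP.
  case=> s /in_joinP [sK vs | sL vs | [[t u] /= [tK uL] ->]].
  - by left; apply/in_verticesP; exists s.
  - by right; apply/in_verticesP; exists s.
  - by rewrite inE => /orP [vt|vu]; [left|right]; apply/in_verticesP; [exists t|exists u].
case=> /in_verticesP [s sK vs]; exists s => //; apply/in_joinP;
  by [constructor 1 | constructor 2].
Qed.

Lemma apex_join K L a :
  simplicial_complex K -> simplicial_complex L ->
  [disjoint vertices K & vertices L] ->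
  apex (join K L) a -> apex K a \/ apex L a.
Proof.
move=> cK cL dKL aP.
have : a \in vertices (join K L).
  by apply/in_verticesP; exists [fset a]; [case: aP | rewrite inE].
rewrite vertices_join inE => /orP [aK | aL].
  by left; apply: apex_join_factorl aP.
by right; apply: (apex_join_factorl L K); rewrite // 1?fdisjoint_sym // joinC.
Qed.

(** The link of [v] in the join is [join (link K v) L]. If its apex lies in the first factor, [v] is
    dominated in [K]; if it lies in [L], then [L] is a cone. *)
Lemma dominated_joinl K L v :
  simplicial_complex K -> simplicial_complex L ->
  [disjoint vertices K & vertices L] -> v \in vertices K ->
  dominated (join K L) v -> dominated K v \/ strong_collapsible L.
Proof.
move=> cK cL dKL vK /(dominatedP _ _ (simplicial_join _ _ cK cL)) [_ [a]].
rewrite link_joinl // => /apex_join [||| aP | aP] //.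
- exact: simplicial_link.
- apply: fdisjointWl dKL; apply: verticesS.
  by apply/fsubsetP => s; rewrite in_link => /andP [].
- by left; apply/dominatedP => //; split=> //; exists a.
- by right; apply: apex_collapsible aP.
Qed.

(** Each step lifts: a vertex dominated in [M] stays dominated in [join M L], since its link there
    is the join of a cone with [L]. *)
Lemma strong_collapse_joinl K K' L :
  simplicial_complex K -> simplicial_complex L ->
  [disjoint vertices K & vertices L] ->
  strong_collapse K K' -> strong_collapse (join K L) (join K' L).
Proof.
move=> cK cL dKL; elim=> [|M v KM IH dv]; first exact: strong_collapse_refl.
have [cM /verticesS MK] := strong_collapse_complex _ _ KM cK.
have dML := fdisjointWl MK dKL.
have [vM [a aP]] := (dominatedP _ _ cM).1 dv.
rewrite -deletion_joinl //; apply: strong_collapse_step => //.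
apply/dominatedP; first exact: simplicial_join.
rewrite vertices_join inE vM link_joinl //; split=> //.
by exists a; apply: apex_joinl.
Qed.

(** Collapsing the factor [K] to a vertex [v] turns the join into a cone with apex [v]. *)
Lemma strong_collapsible_joinl K L :
  simplicial_complex K -> simplicial_complex L ->
  [disjoint vertices K & vertices L] ->
  strong_collapsible K -> strong_collapsible (join K L).
Proof.
move=> cK cL dKL [v vK Kv].
apply: (strong_collapse_collapsible _ (join (vertex_complex v) L)).
- exact: simplicial_join.
- exact: strong_collapse_joinl.
apply: (apex_collapsible _ v).
  exact: simplicial_join (simplicial_vertex_complex v) cL.
apply: apex_joinl; split=> [|t]; first by rewrite inE.
by rewrite !inE => /eqP ->; rewrite fsetUid.
Qed.

(** Invariant along a collapse of the join: the current complex is a join of collapses of the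
    factors, until a vertex is dominated only because the opposite factor has become a cone. From
    then on one of the last two alternatives holds, and later steps preserve it. *)
Lemma strong_collapse_join_inv K L M :
  simplicial_complex K -> simplicial_complex L ->
  [disjoint vertices K & vertices L] ->
  strong_collapse (join K L) M ->
  [\/ exists K' L', [/\ strong_collapse K K', strong_collapse L L'
                      & M = join K' L'],
      strong_collapsible K | strong_collapsible L].
Proof.
move=> cK cL dKL; elim=> [|N v _ [[K' [L' [KK' LL' NE]]] | |] dv];
  [| |by constructor 2|by constructor 3].
  by constructor 1; exists K, L; split=> //; apply: strong_collapse_refl.
rewrite {N}NE in dv *.
have [cK' /verticesS K'K] := strong_collapse_complex _ _ KK' cK.
have [cL' /verticesS L'L] := strong_collapse_complex _ _ LL' cL.
have dKL' := fdisjointWl K'K (fdisjointWr L'L dKL).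
have dLK' : [disjoint vertices L' & vertices K'] by rewrite fdisjoint_sym.
have := dv.1; rewrite vertices_join inE => /orP [vK | vL].
  have [dK | sL] := dominated_joinl _ _ _ cK' cL' dKL' vK dv.
    constructor 1; exists (deletion K' v), L'; split=> //.
      exact: strong_collapse_step.
    exact: deletion_joinl.
  by constructor 3; apply: strong_collapse_collapsible LL' sL.
(* A vertex of [L'] is treated symmetrically, with the factors exchanged. *)
rewrite joinC in dv *.
have [dL | sK] := dominated_joinl _ _ _ cL' cK' dLK' vL dv.
  constructor 1; exists K', (deletion L' v); split=> //.
    exact: strong_collapse_step.
  by rewrite deletion_joinl // joinC.
by constructor 2; apply: strong_collapse_collapsible KK' sK.
Qed.

End Complexes.

Theorem proposition2p15 (V : choiceType) (K L : {fset {fset V}})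
    (hK : simplicial_complex K) (hL : simplicial_complex L)
    (hKL : [disjoint vertices K & vertices L]) :
  strong_collapsible (join K L) <-> strong_collapsible K \/ strong_collapsible L.
Proof.
split=> [[v _] | [sK | sL]]; last 2 first.
- exact: strong_collapsible_joinl.
- by rewrite joinC; apply: strong_collapsible_joinl; rewrite // fdisjoint_sym.
case/strong_collapse_join_inv=> // [[K' [L' [KK' LL' E]]] | |]; [|by left|by right].
have [cK' /verticesS K'K] := strong_collapse_complex _ _ KK' hK.
have [cL' /verticesS L'L] := strong_collapse_complex _ _ LL' hL.
have dKL' := fdisjointWl K'K (fdisjointWr L'L hKL).
(* The final vertex [v] of the collapse is itself a cone with apex [v], and it equals [join K' L'];
   hence [K'] or [L'] is a cone. *)
have : apex (join K' L') v.
  by rewrite -E; split=> [|t]; rewrite !inE // => /eqP ->; rewrite fsetUid.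
case/apex_join=> // [aP | aP]; [left | right].
  exact: strong_collapse_collapsible KK' (apex_collapsible _ _ cK' aP).
exact: strong_collapse_collapsible LL' (apex_collapsible _ _ cL' aP).
Qed.
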